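(* (1) $\mathbf{K_N^{Horn,\Box}}\prec\mathbf{K_N^{Horn}}$; (2) $\mathbf{K_N^{core,\Box}}\prec\mathbf{K_N^{core}}$.
   Context: Fix a finite set $\tau$ of modality labels and a countable set $\mathcal P$ of propositional letters. Formulas of $\mathbf{K_N}$ are generated by $\varphi ::= \top \mid p \mid \neg\varphi \mid \varphi\vee\varphi \mid \Diamond_\alpha\varphi \mid \Box_\alpha\varphi$; $\wedge,\rightarrow$ are abbreviations, $\bot=\neg\top$. Models $M=(\mathcal F,V)$ with frame $\mathcal F=(W,\{R_\alpha\}_{\alpha\in\tau})$, $W\neq\emptyset$, $R_\alpha\subseteq W\times W$, $V:W\to2^{\mathcal P}$, standard Kripke semantics. Positive literals: $\lambda ::= \top \mid p \mid \Diamond_\alpha\lambda \mid \Box_\alpha\lambda$. Clausal form: $\varphi ::= \lambda \mid \neg\lambda \mid \nabla(\neg\lambda_1\vee\dots\vee\neg\lambda_n\vee\lambda_{n+1}\vee\dots\vee\lambda_{n+m}) \mid \varphi\wedge\varphi$, with positive literals $\lambda,\lambda_i$ and $\nabla$ a finite (possibly empty) sequence of boxes. $\mathbf{K_N^{Horn}}$: every clause has $m\le1$; $\mathbf{K_N^{Krom}}$: $n+m\le2$; $\mathbf{K_N^{core}}$: both. For $X\in\{\mathrm{Horn},\mathrm{core}\}$, $\mathbf{K_N^{X,\Box}}$ is the subfragment of $\mathbf{K_N^{X}}$ in which positive literals contain no diamonds ($\lambda::=\top\mid p\mid\Box_\alpha\lambda$; prefixes $\nabla$ unchanged). Strong expressivity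 (over all Kripke frames): for a model $M=(\mathcal F,V)$ over $\mathcal P$ and $\mathcal P'\supseteq\mathcal P$, an extension of $M$ is a model $(\mathcal F,V')$ over $\mathcal P'$ with $V'$ agreeing with $V$ on $\mathcal P$. $\mathbf L\preceq\mathbf L'$ if there is an effective translation taking each $\mathbf L$-formula $\varphi$ over $\mathcal P$ to an $\mathbf L'$-formula $\varphi'$ over some alphabet $\mathcal P'\supseteq\mathcal P$ (adding finitely many new letters) such that for every model $M$ over $\mathcal P$ and world $w$: $M,w\Vdash\varphi$ iff some extension $M'$ of $M$ to $\mathcal P'$ satisfies $M',w\Vdash\varphi'$. $\mathbf L\equiv\mathbf L'$ means $\mathbf L\preceq\mathbf L'$ and $\mathbf L'\preceq\mathbf L$; $\mathbf L\prec\mathbf L'$ means $\mathbf L\preceq\mathbf L'$ and not $\mathbf L\equiv\mathbf L'$. *)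

(* Defs.v *)
From mathcomp Require Import all_boot.

Set Implicit Arguments.
Unset Strict Implicit.
Unset Printing Implicit Defensive.

Section Syntax.
Context {tau : Type} {P : Type}.

Inductive form : Type :=
| Top
| Var of P
| Neg of form
| Or of form & form
| Dia of tau & form
| Box of tau & form.

Definition Bot : form := Neg Top.
Definition And (f g : form) : form := Neg (Or (Neg f) (Neg g)).

Fixpoint boxes (s : seq tau) (f : form) : form :=
  if s is a :: s' then Box a (boxes s' f) else f.

(* Associates to the right; the empty disjunction is Bot. *)
Fixpoint disj (s : seq form) : form :=
  match s with
  | [::] => Bot
  | [:: f] => f
  | f :: s' => Or f (disj s')
  end.

Fixpoint positive_literal (f : form) : bool :=
  match f with
  | Top | Var _ => true
  | Dia _ g | Box _ g => positive_literal g
  | Neg _ | Or _ _ => false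
  end.

Fixpoint box_positive_literal (f : form) : bool :=
  match f with
  | Top | Var _ => true
  | Box _ g => box_positive_literal g
  | Dia _ _ | Neg _ | Or _ _ => false
  end.

(* [bound n m] restricts the numbers n of negated and m of unnegated positive
   literals in each clause. *)
Inductive clausal (lit : form -> bool) (bound : nat -> nat -> bool) :
    form -> Prop :=
| clausal_pos l : lit l -> clausal lit bound l
| clausal_neg l : lit l -> clausal lit bound (Neg l)
| clausal_clause nabla neg pos :
    all lit neg -> all lit pos -> bound (size neg) (size pos) ->
    clausal lit bound (boxes nabla (disj ([seq Neg l | l <- neg] ++ pos)))
| clausal_and f g :
    clausal lit bound f -> clausal lit bound g -> clausal lit bound (And f g).

End Syntax.

Arguments form : clear implicits.

Definition horn_bound (n m : nat) : bool := m <= 1.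
Definition krom_bound (n m : nat) : bool := n + m <= 2.
Definition core_bound (n m : nat) : bool := horn_bound n m && krom_bound n m.

(* A fragment gives its set of formulas over every alphabet. *)
Definition fragment (tau : Type) := forall P : Type, form tau P -> Prop.

Definition K_Horn (tau : Type) : fragment tau :=
  fun P => clausal (@positive_literal tau P) horn_bound.
Definition K_Horn_box (tau : Type) : fragment tau :=
  fun P => clausal (@box_positive_literal tau P) horn_bound.
Definition K_core (tau : Type) : fragment tau :=
  fun P => clausal (@positive_literal tau P) core_bound.
Definition K_core_box (tau : Type) : fragment tau :=
  fun P => clausal (@box_positive_literal tau P) core_bound.

Record frame (tau : Type) := Frame {
  world : Type;
  world_inhabited : inhabited world;
  acc : tau -> world -> world -> Prop }.

Definition valuation (tau P : Type) (F : frame tau) := world F -> P -> Prop.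
Arguments valuation {tau} P F.

Fixpoint sat (tau P : Type) (F : frame tau) (V : valuation P F) (w : world F)
    (f : form tau P) : Prop :=
  match f with
  | Top => True
  | Var p => V w p
  | Neg g => ~ sat V w g
  | Or g h => sat V w g \/ sat V w h
  | Dia a g => exists v, acc a w v /\ sat V v g
  | Box a g => forall v, acc a w v -> sat V v g
  end.

(* P + 'I_k is P enlarged with k new letters. *)
Definition extends (tau P : Type) (k : nat) (F : frame tau)
    (V : valuation P F) (V' : valuation (P + 'I_k) F) : Prop :=
  forall w p, V' w (inl p) <-> V w p.

(* Syntax and (partial) evaluation of the mu-recursive functions. *)
Inductive mu_rec : Type :=
| MZero
| MSucc
| MProj of nat
| MComp of mu_rec & seq mu_rec
| MPrec of mu_rec & mu_rec
| MMin of mu_rec.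

Inductive mu_eval : mu_rec -> seq nat -> nat -> Prop :=
| eval_zero xs : mu_eval MZero xs 0
| eval_succ x : mu_eval MSucc [:: x] x.+1
| eval_proj i xs : i < size xs -> mu_eval (MProj i) xs (nth 0 xs i)
| eval_comp f gs xs ys y :
    mu_evals gs xs ys -> mu_eval f ys y -> mu_eval (MComp f gs) xs y
| eval_prec0 f g xs y : mu_eval f xs y -> mu_eval (MPrec f g) (0 :: xs) y
| eval_precS f g n xs r y :
    mu_eval (MPrec f g) (n :: xs) r -> mu_eval g (n :: r :: xs) y ->
    mu_eval (MPrec f g) (n.+1 :: xs) y
| eval_min f xs n :
    mu_eval f (n :: xs) 0 ->
    (forall i, i < n -> exists m, mu_eval f (i :: xs) m.+1) ->
    mu_eval (MMin f) xs n
with mu_evals : seq mu_rec -> seq nat -> seq nat -> Prop :=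
| evals_nil xs : mu_evals [::] xs [::]
| evals_cons g gs xs y ys :
    mu_eval g xs y -> mu_evals gs xs ys -> mu_evals (g :: gs) xs (y :: ys).

Fixpoint form_tree (tau : finType) (P : Type) (num : P -> nat)
    (f : form tau P) : GenTree.tree nat :=
  match f with
  | Top => GenTree.Node 0 [::]
  | Var p => GenTree.Leaf (num p)
  | Neg g => GenTree.Node 1 [:: form_tree num g]
  | Or g h => GenTree.Node 2 [:: form_tree num g; form_tree num h]
  | Dia a g => GenTree.Node 3 [:: GenTree.Leaf (pickle a); form_tree num g]
  | Box a g => GenTree.Node 4 [:: GenTree.Leaf (pickle a); form_tree num g]
  end.

(* Goedel number of a formula, relative to a numbering of the letters. *)
Definition form_code (tau : finType) (P : Type) (num : P -> nat)
    (f : form tau P) : nat := pickle (form_tree num f).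

(* A single numbering for all letters: those of P get even numbers, new ones
   odd numbers. *)
Definition letter_num (P : countType) (p : P) : nat := (pickle p).*2.
Definition ext_letter_num (P : countType) (k : nat) (q : P + 'I_k) : nat :=
  match q with inl p => letter_num p | inr i => (val i).*2.+1 end.

Definition translation (tau : Type) (P : Type) :=
  form tau P -> {k : nat & form tau (P + 'I_k)}.

Definition effective (tau : finType) (P : countType) (L : fragment tau)
    (t : translation tau P) : Prop :=
  exists e1 e2 : mu_rec, forall f : form tau P, L P f ->
    let c := form_code (@letter_num P) f in
    mu_eval e1 [:: c] (projT1 (t f)) /\
    mu_eval e2 [:: c] (form_code (@ext_letter_num P _) (projT2 (t f))).

Definition expr_le (tau : finType) (P : countType) (L L' : fragment tau) :
    Prop :=
  exists t : translation tau P, effective L t /\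
    forall f : form tau P, L P f ->
      L' _ (projT2 (t f)) /\
      forall (F : frame tau) (V : valuation P F) (w : world F),
        sat V w f <->
        exists V', extends V V' /\ sat V' w (projT2 (t f)).

Definition expr_equiv (tau : finType) (P : countType) (L L' : fragment tau) :
    Prop :=
  expr_le P L L' /\ expr_le P L' L.

Definition expr_lt (tau : finType) (P : countType) (L L' : fragment tau) :
    Prop :=
  expr_le P L L' /\ ~ expr_equiv P L L'.

(* Main.v *)
Require Import Defs.
From mathcomp Require Import all_boot.
From Stdlib Require Import Classical.

Set Implicit Arguments.
Unset Strict Implicit.
Unset Printing Implicit Defensive.

(** Over a fixed frame, the pointwise intersection of two valuations satisfies a
    diamond-free positive literal exactly when both valuations do, because boxes
    commute with conjunction.  Hence the valuations satisfying a given
    [K_Horn_box]-formula are closed under intersection.  This closure survives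
    the projection to the original letters that defines strong expressivity,
    whereas [Dia a p], a formula of [K_core], violates it at a world with two
    successors: make [p] true at one successor only, in the two possible ways. *)

Section MapForm.
Variables (tau P Q : Type) (h : P -> Q).

(** A translation lands in the enlarged alphabet [P + 'I_k], a different type, so even an inclusion
    of fragments has to rename letters. *)
Fixpoint map_form (f : form tau P) : form tau Q :=
  match f with
  | Top => Top
  | Var p => Var (h p)
  | Neg g => Neg (map_form g)
  | Or g k => Or (map_form g) (map_form k)
  | Dia a g => Dia a (map_form g)
  | Box a g => Box a (map_form g)
  end.

Lemma map_form_boxes s f : map_form (boxes s f) = boxes s (map_form f).
Proof. by elim: s => //= a s ->. Qed.

Lemma map_form_disj s : map_form (disj s) = disj [seq map_form f | f <- s].
Proof. by elim: s => //= f [|g s] //= ->. Qed.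

Lemma positive_literal_map_form f :
  positive_literal (map_form f) = positive_literal f.
Proof. by elim: f. Qed.

Lemma clausal_map_form (lit : form tau P -> bool) (lit' : form tau Q -> bool)
    bound f :
  (forall l, lit l -> lit' (map_form l)) ->
  clausal lit bound f -> clausal lit' bound (map_form f).
Proof.
move=> lit_map; elim=> [l ll|l ll|nabla neg pos ln lp b|g k _ cg _ ck] /=.
- exact/clausal_pos/lit_map.
- exact/clausal_neg/lit_map.
- have all_map_lit s : all lit s -> all lit' [seq map_form l | l <- s].
    by rewrite all_map; apply: sub_all.
  rewrite map_form_boxes map_form_disj map_cat -map_comp.
  (* Moving [Neg] outside the renaming restores the shape that [clausal_clause] expects. *)
  rewrite (eq_map (_ : map_form \o Neg =1 Neg \o map_form)) // map_comp.
  by apply: clausal_clause; rewrite ?size_map //; apply: all_map_lit.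
- exact: clausal_and.
Qed.

Lemma sat_map_form (F : frame tau) (V : valuation P F) (V' : valuation Q F) w f :
  (forall w p, V' w (h p) <-> V w p) -> sat V' w (map_form f) <-> sat V w f.
Proof.
move=> VV'; elim: f w => [|p|g IH|g IHg k IHk|a g IH|a g IH] w //=.
- by rewrite IH.
- by rewrite IHg IHk.
- by split=> -[v [wv gv]]; exists v; split=> //; apply/IH.
- by split=> wg v /wg /IH.
Qed.

End MapForm.

Lemma form_code_map_form (tau : finType) (P Q : Type) (h : P -> Q)
    (num : P -> nat) (num' : Q -> nat) (f : form tau P) :
  (forall p, num' (h p) = num p) ->
  form_code num' (map_form h f) = form_code num f.
Proof.
move=> numE; rewrite /form_code; congr pickle.
by elim: f => //= [p|g ->|g -> k ->|a g ->|a g ->] //; rewrite numE.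
Qed.

Lemma box_positive_literalW (tau P : Type) (l : form tau P) :
  box_positive_literal l -> positive_literal l.
Proof. by elim: l. Qed.

(* Old letters keep their numbers in the enlarged alphabet, so adding no letter
   leaves the Goedel number unchanged and a projection computes the translation. *)
Lemma expr_le_map_form (tau : finType) (P : countType) (L L' : fragment tau) :
  (forall (Q : Type) (h : P -> Q) f, L P f -> L' Q (map_form h f)) ->
  expr_le P L L'.
Proof.
move=> LL'; pose emb : P -> P + 'I_0 := inl.
exists (fun f => existT _ 0 (map_form emb f)); split.
  exists MZero, (MProj 0) => f _ /=; split; first exact: eval_zero.
  by rewrite (form_code_map_form (num := @letter_num P)) //; apply: eval_proj.
move=> f Lf; split=> [|F V w /=]; first exact: LL'.
split=> [Vf|[V' [VV' V'f]]]; last exact/(sat_map_form w f VV').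
(* The value [False] is a dummy: ['I_0] is empty. *)
exists (fun w q => if q is inl p then V w p else False); split=> //.
exact/(sat_map_form (V := V)).
Qed.

Section Meet.
Variables (tau P : Type) (F : frame tau).
Implicit Types (V : valuation P F) (f g l : form tau P).

Definition meet V1 V2 : valuation P F := fun w p => V1 w p /\ V2 w p.

Lemma sat_meet_literal V1 V2 w l : box_positive_literal l ->
  sat (meet V1 V2) w l <-> sat V1 w l /\ sat V2 w l.
Proof.
elim: l w => [|p|||//|a g IH] //= w lg.
split=> [mg|[V1g V2g] v wv]; last by apply/IH => //; split; auto.
by split=> v /mg /IH[].
Qed.

Lemma sat_and V w f g : sat V w (And f g) <-> sat V w f /\ sat V w g.
Proof. rewrite /=; tauto. Qed.

Lemma sat_disj_cons V w f s :
  sat V w (disj (f :: s)) <-> sat V w f \/ sat V w (disj s).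
Proof. case: s => [|g s] /=; tauto. Qed.

Definition meet_closed f := forall V1 V2 w,
  sat V1 w f -> sat V2 w f -> sat (meet V1 V2) w f.

Lemma meet_closed_boxes s f : meet_closed f -> meet_closed (boxes s f).
Proof.
by move=> mf; elim: s => //= a s IH V1 V2 w V1f V2f v wv; apply: IH; auto.
Qed.

(** If the meet satisfies every literal of [neg], so do both valuations; both then satisfy the
    single head, and hence so does the meet. With two heads, each valuation could satisfy a
    different one. *)
Lemma meet_closed_horn neg pos :
  all box_positive_literal neg -> all box_positive_literal pos ->
  size pos <= 1 -> meet_closed (disj ([seq Neg l | l <- neg] ++ pos)).
Proof.
move=> ln lp pos1 V1 V2 w; elim: neg ln => [_|l neg IH /andP[ll ln]].
  case: pos pos1 lp => [|l [|//]] _ /=; first tauto.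
  by rewrite andbT => ll ? ?; apply/sat_meet_literal.
rewrite map_cons cat_cons !sat_disj_cons /=.
have := sat_meet_literal V1 V2 w ll; have := IH ln.
by have := classic (sat (meet V1 V2) w l); tauto.
Qed.

Lemma meet_closed_K_Horn_box f : K_Horn_box f -> meet_closed f.
Proof.
elim=> [l ll|l ll|nabla neg pos ln lp b|g k _ mg _ mk] V1 V2 w.
- by move=> V1l V2l; apply/sat_meet_literal.
- by move=> /= V1l _ /sat_meet_literal-/(_ ll)[].
- exact/meet_closed_boxes/meet_closed_horn.
- by rewrite !sat_and => -[? ?] [? ?]; split; [apply: mg | apply: mk].
Qed.

End Meet.

Definition fork_frame (tau : Type) : frame tau :=
  Frame (inhabits None) (fun _ (w v : option bool) => w = None /\ v <> None).

Lemma dia_not_expressible_horn_box (tau P : Type) (k : nat) (a : tau) (p : P)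
    (g : form tau (P + 'I_k)) :
  K_Horn_box g ->
  ~ (forall (F : frame tau) (V : valuation P F) (w : world F),
       sat V w (Dia a (Var p)) <-> exists V', extends V V' /\ sat V' w g).
Proof.
move=> Hg gP.
(* All letters are treated alike, which avoids comparing them with [p]. *)
pose V b : valuation P (fork_frame tau) := fun w _ => w = Some b.
have Vp b : sat (V b) None (Dia a (Var p)) by exists (Some b).
have [V1 [e1 s1]] := (gP _ _ _).1 (Vp true).
have [V2 [e2 s2]] := (gP _ _ _).1 (Vp false).
(* A successor satisfying [p] under the meet would equal both [Some true] and [Some false]. *)
have /gP[v [_ [/= -> //]]] :
    exists V', extends (meet (V true) (V false)) V' /\ sat V' None g.
(* The meet of two extensions extends the meet, whatever they do on the new letters. *)
exists (meet V1 V2); split; last exact: meet_closed_K_Horn_box.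
by move=> w q; rewrite /meet e1 e2.
Qed.

Lemma clausal_subbound (tau P : Type) (lit : form tau P -> bool)
    (b b' : nat -> nat -> bool) f :
  (forall n m, b n m -> b' n m) -> clausal lit b f -> clausal lit b' f.
Proof.
move=> bb'; elim=> [l ll|l ll|nabla neg pos ln lp /bb' c|g k _ cg _ ck].
- exact: clausal_pos.
- exact: clausal_neg.
- exact: clausal_clause.
- exact: clausal_and.
Qed.

(** Stated for any target inside [K_Horn_box], to serve the Horn and the core case at once; the
    inclusion ranges over all alphabets because the translation chooses its own. *)
Lemma not_expr_le_horn_box (tau : finType) (P : countType) (L L' : fragment tau)
    (a : tau) (p : P) :
  L P (Dia a (Var p)) ->
  (forall (Q : Type) (f : form tau Q), L' Q f -> K_Horn_box f) ->
  ~ expr_le P L L'.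
Proof.
move=> Lf L'H [t [_ /(_ _ Lf)[/L'H Hg gP]]].
exact: dia_not_expressible_horn_box Hg gP.
Qed.

Theorem theorem3 (tau : finType) (P : countType)
    (tau_inhabited : inhabited tau) (P_inhabited : inhabited P) :
  expr_lt P (@K_Horn_box tau) (@K_Horn tau) /\
  expr_lt P (@K_core_box tau) (@K_core tau).
Proof.
case: tau_inhabited P_inhabited => [a] [p].
have box_map (Q : Type) (h : P -> Q) (l : form tau P) :
    box_positive_literal l -> positive_literal (map_form h l).
  by rewrite positive_literal_map_form; apply: box_positive_literalW.
split; split.
- apply: expr_le_map_form => Q h f; apply: clausal_map_form; apply: box_map.
- case=> _; apply: (@not_expr_le_horn_box _ _ _ _ a p) => //.
  exact: clausal_pos.
- apply: expr_le_map_form => Q h f; apply: clausal_map_form; apply: box_map.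
- case=> _; apply: (@not_expr_le_horn_box _ _ _ _ a p) => [|Q f].
    exact: clausal_pos.
  (* [core_bound] implies [horn_bound], so [K_core_box] lies inside [K_Horn_box]. *)
  by apply: clausal_subbound => n m /andP[].
Qed.
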